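(* For every integer $q\ge 3$, the border rank of the Kronecker square of the little Coppersmith--Winograd tensor $T_{cw,q}$ is $$\underline{\mathbf R}\bigl(T_{cw,q}^{\boxtimes 2}\bigr)=(q+2)^2 .$$
   Context: All vector spaces are finite-dimensional over $\mathbb{C}$. For $T\in A\otimes B\otimes C$, the tensor rank $\mathrm{R}(T)$ is the least $r$ such that $T=\sum_{\ell=1}^{r}x_\ell\otimes y_\ell\otimes z_\ell$ with $x_\ell\in A$, $y_\ell\in B$, $z_\ell\in C$. The border rank $\underline{\mathbf R}(T)$ is the least $r$ such that $T$ is a limit of tensors of rank at most $r$ (limit in the Euclidean topology; equivalently, $T$ lies in the Zariski closure of the set of tensors of rank at most $r$). For $q\ge 1$ let $A,B,C$ be copies of $\mathbb{C}^{q+1}$ with bases $\{a_0,\dots,a_q\}$, $\{b_0,\dots,b_q\}$, $\{c_0,\dots,c_q\}$. The little Coppersmith--Winograd tensor is $$T_{cw,q}=\sum_{j=1}^{q}\bigl(a_0\otimes b_j\otimes c_j+a_j\otimes b_0\otimes c_j+a_j\otimes b_j\otimes c_0\bigr)\in A\otimes B\otimes C.$$ The Kronecker product of $T\in A\otimes B\otimes C$ and $S\in A_1\otimes B_1\otimes C_1$ is the tensor $T\boxtimes S\in (A\otimes A_1)\otimes(B\otimes B_1)\otimes(C\otimes C_1)$, regarded as a tensor with three factors, defined bilinearly by $(a\otimes b\otimes c)\boxtimes(a'\otimes b'\otimes c')=(a\otimes a')\otimes(b\otimes b')\otimes(c\otimes c')$. Kronecker powers are $T^{\boxtimes 1}=T$,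 $T^{\boxtimes m}=T^{\boxtimes(m-1)}\boxtimes T$, so $T^{\boxtimes m}\in A^{\otimes m}\otimes B^{\otimes m}\otimes C^{\otimes m}$, a three-factor tensor. *)

(* Defs.v *)
From HB Require Import structures.
From mathcomp Require Import all_boot all_order all_algebra.
From mathcomp Require Import complex.
From mathcomp Require Import all_classical all_reals all_analysis.

Set Implicit Arguments.
Unset Strict Implicit.
Unset Printing Implicit Defensive.

Import Order.TTheory GRing.Theory Num.Theory.
Import numFieldNormedType.Exports.

Local Open Scope classical_set_scope.
Local Open Scope ring_scope.

Definition Cplx (R : realType) : numClosedFieldType := R[i]%C.

(* Finite-dimensional spaces come with bases: the space with a basis indexed by
   the finite type I is I -> F.  Thus A (x) B (x) C is I * J * K -> F (a tensor
   is given by its coordinates in the product basis), and A (x) A' is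
   I * I' -> F. *)
Notation tensor3 F I J K := (I * J * K -> F) (only parsing).

Definition basisv (F : numFieldType) (I : finType) (i : I) : I -> F :=
  fun i' => (i' == i)%:R.

Definition tens3 (F : numFieldType) (I J K : finType)
    (x : I -> F) (y : J -> F) (z : K -> F) : tensor3 F I J K :=
  fun p => x p.1.1 * y p.1.2 * z p.2.

Definition rank_decomp (F : numFieldType) (I J K : finType)
    (T : tensor3 F I J K) (r : nat) : Prop :=
  exists (x : 'I_r -> I -> F) (y : 'I_r -> J -> F)
         (z : 'I_r -> K -> F),
    T = \sum_(l < r) tens3 (x l) (y l) (z l).

Lemma sum_tensor3E (F : numFieldType) (I J K : finType) (L : Type) (s : seq L)
    (P : pred L) (G : L -> tensor3 F I J K) (p : I * J * K) :
  (\sum_(l <- s | P l) G l) p = \sum_(l <- s | P l) G l p.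
Proof. by elim/big_rec2: _ => //= l a b _ <-. Qed.

Lemma rank_decomp_exists (F : numFieldType) (I J K : finType)
    (T : tensor3 F I J K) : exists r, `[< rank_decomp T r >].
Proof.
exists #|{: I * J * K}|; apply/asboolP.
exists (fun l i => T (enum_val l) * basisv F (enum_val l).1.1 i),
       (fun l => basisv F (enum_val l).1.2), (fun l => basisv F (enum_val l).2).
apply/funext => -[[i j] k]; rewrite sum_tensor3E.
rewrite (bigD1 (enum_rank (i, j, k))) //= /tens3 /basisv enum_rankK /= !eqxx.
rewrite !mulr1 big1 ?addr0 // => l; rewrite -(inj_eq enum_val_inj) enum_rankK.
case: (enum_val l) => -[i' j'] k' /=.
rewrite !xpair_eqE (eq_sym i) (eq_sym j) (eq_sym k).
by do 3! case: eqP => ? /=; rewrite ?(mulr0, mul0r).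
Qed.

Definition tensor_rank (F : numFieldType) (I J K : finType)
    (T : tensor3 F I J K) : nat :=
  ex_minn (rank_decomp_exists T).

(* On a finite power of F = Cplx R the Euclidean topology is the product
   topology, i.e. that of pointwise convergence of coordinates. *)
Definition limit_of_rank_le (F : numFieldType) (I J K : finType)
    (T : tensor3 F I J K) (r : nat) : Prop :=
  exists u : nat -> tensor3 F I J K,
    (forall n, (tensor_rank (u n) <= r)%N) /\
    {ptws, u @ \oo --> T}.

Lemma limit_of_rank_le_exists (F : numFieldType) (I J K : finType)
    (T : tensor3 F I J K) : exists r, `[< limit_of_rank_le T r >].
Proof.
exists (tensor_rank T); apply/asboolP; exists (fun=> T); split=> //.
exact: (@cvg_cst {ptws I * J * K -> F}).
Qed.

Definition border_rank (F : numFieldType) (I J K : finType)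
    (T : tensor3 F I J K) : nat :=
  ex_minn (limit_of_rank_le_exists T).

Definition kron (F : numFieldType) (I J K I' J' K' : finType)
    (T : tensor3 F I J K) (S : tensor3 F I' J' K') :
    tensor3 F (I * I')%type (J * J')%type (K * K')%type :=
  fun p => T (p.1.1.1, p.1.2.1, p.2.1) * S (p.1.1.2, p.1.2.2, p.2.2).

(* kron is the bilinear map prescribed on decomposable tensors by kron_tens3,
   where tensv x x' is the vector x (x) x'. *)
Definition tensv (F : numFieldType) (I I' : finType) (x : I -> F)
    (x' : I' -> F) : I * I' -> F :=
  fun p => x p.1 * x' p.2.

Lemma kron_tens3 (F : numFieldType) (I J K I' J' K' : finType)
    (x : I -> F) (y : J -> F) (z : K -> F)
    (x' : I' -> F) (y' : J' -> F) (z' : K' -> F) :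
  kron (tens3 x y z) (tens3 x' y' z') =
  tens3 (tensv x x') (tensv y y') (tensv z z').
Proof.
by apply/funext => p; rewrite /kron /tens3 /tensv /= mulrACA [X in X * _]mulrACA.
Qed.

Lemma kron_bilinear (F : numFieldType) (I J K I' J' K' : finType) (a : F)
    (T1 T2 : tensor3 F I J K) (S1 S2 : tensor3 F I' J' K') :
  kron (fun p => a * T1 p + T2 p) S1 =
    (fun p => a * kron T1 S1 p + kron T2 S1 p) /\
  kron T1 (fun p => a * S1 p + S2 p) =
    (fun p => a * kron T1 S1 p + kron T1 S2 p).
Proof.
split; apply/funext => p; rewrite /kron; first by rewrite mulrDl mulrA.
by rewrite mulrDr mulrCA.
Qed.

Definition Tcw (F : numFieldType) (q : nat) :
    tensor3 F 'I_q.+1 'I_q.+1 'I_q.+1 :=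
  let e := @basisv F 'I_q.+1 in
  \sum_(j < q.+1 | j != ord0)
    (tens3 (e ord0) (e j) (e j) + tens3 (e j) (e ord0) (e j)
     + tens3 (e j) (e j) (e ord0)).

Arguments Tcw F q _ : clear implicits.

(* Main.v *)
Require Import Defs.
From mathcomp Require Import all_boot all_order all_algebra.
From mathcomp Require Import complex.
From mathcomp Require Import all_classical all_reals all_analysis.
From mathcomp Require Import ring zify.

Set Implicit Arguments.
Unset Strict Implicit.
Unset Printing Implicit Defensive.

Import Order.TTheory GRing.Theory Num.Theory.
Import numFieldNormedType.Exports.

Local Open Scope classical_set_scope.
Local Open Scope ring_scope.

(** Upper bound.  With s = e_1 + ... + e_q, the combination
      t^-2 sum_j (e_0 + t e_j)^(x)3 - t^-3 (e_0 + t^2 s)^(x)3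
    of q + 1 rank one tensors is T_cw,q + O(t) up to a multiple of e_0^(x)3,
    which costs one more rank one tensor ([cw_degenerationE]).  Decompositions
    multiply under the Kronecker product, whence (q + 2)^2 terms for the
    square.

    Lower bound.  Project the first factor of T in A (x) B (x) C to a space of
    dimension 5 and wedge with it: the Koszul flattening is a linear map
      Lambda^2 C^5 (x) B^* -> Lambda^3 C^5 (x) C
    that depends linearly on T.  On x (x) y (x) z, with x projecting to v, it
    is (v /\ _) (x) (y (x) z), and v /\ _ has rank at most
    dim Lambda^2 (C^5 / v) = 6 ([wedge2_mx_rank]).  Hence rank r tensors have
    flattenings of rank at most 6 r; since this is the vanishing of minors, it
    passes to limits.  So a nonvanishing minor of size m forces border rank at
    least m / 6 ([koszul_minor_border_rank]), and for the square of T_cw,q a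
    minor of size more than 6 ((q + 2)^2 - 1) is wanted.

    Let M_0, ..., M_q be the slices of T_cw,q along the first factor:
    M_0 = diag(0, 1, ..., 1) and M_i = E_{0i} + E_{i0}.  The slices of the
    square are the M_i (x) M_j, and the projection to C^5 amounts to the choice
    of five combinations of them.  The choice made here is
      M_0 (x) M_0,
      M_0 (x) M_1 + M_1 (x) M_0 + M_1 (x) M_3,
      M_0 (x) M_2 + M_2 (x) M_0,
      M_0 (x) M_3 + M_3 (x) M_0 + M_3 (x) M_2,
      M_1 (x) M_1 + M_3 (x) M_3.
    Only indices up to 3 occur, and on the k = q - 3 coordinates 4, ..., q the
    matrix M_0 is the identity while M_1, M_2, M_3 vanish.  The flattening is
    therefore block diagonal: one block for both coordinates below 4 (the case
    q = 3), 2 k blocks with one fixed coordinate at least 4, in which only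
    the M_i (x) M_0 or the M_0 (x) M_i survive, and k^2 blocks with both
    coordinates fixed and at least 4, in which only M_0 (x) M_0 survives.
    These blocks are very sparse, and they contain triangular submatrices with
    nonzero diagonal of sizes 146, 30 and 6 ([pivotsP]).  Together they give a
    nonzero minor of size
      146 + 60 k + 6 k^2 = 6 ((k + 5)^2 - 1) + 2,
    which is just large enough. *)

(** * Pointwise limits and triangular minors *)

Lemma ptws_cvgP (X : choiceType) (V : topologicalType) (u : nat -> X -> V)
    (f : X -> V) :
  {ptws, u @ \oo --> f} <-> forall t, u n t @[n --> \oo] --> f t.
Proof.
split=> [uf t|uf].
  move=> A /(@proj_continuous _ (fun=> V) t f)/uf; exact.
apply/cvg_sup => t.
have onto : range (fun g : X -> V => g t) = [set: V].
  by apply/seteqP; split=> // y _; exists (fun=> y).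
apply/(cvg_image _ _ onto) => U /(uf t) uU.
by exists ((fun g : X -> V => g t) @^-1` U) => //; rewrite image_preimage.
Qed.

(** Taking the pivots in order of [ord] makes the matrix triangular; stating
    this for an arbitrary finite type of pivots, with [ord] not necessarily
    injective, lets independent blocks be ordered separately. *)
Lemma triangular_det_neq0 (F : fieldType) (Q : finType) (M : Q -> Q -> F)
    (ord : Q -> nat) :
  (forall p, M p p != 0) ->
  (forall p p', p != p' -> (ord p <= ord p')%N -> M p p' = 0) ->
  \det (\matrix_(i < #|Q|, j < #|Q|) M (enum_val i) (enum_val j)) != 0.
Proof.
(* A row vector killed by M vanishes at the pivots of largest ord first. *)
move=> diag upper; apply/det0P => -[v v_neq0 vM0].
case/negP: v_neq0; apply/eqP/rowP => i; rewrite [RHS]mxE.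
have [b ordb] : exists b, forall p, (ord p <= b)%N.
  by exists (\max_p ord p)%N => p; apply: leq_bigmax.
have [m] := ubnP (b - ord (enum_val i)); elim: m i => // m IH i.
rewrite ltnS => le_m.
have /rowP/(_ i) := vM0; rewrite !mxE (bigD1 i) //= big1 => [|j j_neq_i].
  by rewrite addr0 mxE => /eqP; rewrite mulf_eq0 (negPf (diag _)) orbF => /eqP.
rewrite mxE; have [le_ij|lt_ij] := leqP (ord (enum_val j)) (ord (enum_val i)).
  by rewrite upper ?mulr0 ?(inj_eq enum_val_inj).
rewrite IH ?mul0r //; apply: leq_trans le_m.
by apply: ltn_sub2l => //; apply: leq_trans lt_ij _.
Qed.

(** * Exterior multiplication on Lambda^2 C^5 *)

Fixpoint inversions (s : seq nat) : nat :=
  if s is x :: s' then (count (fun y => y < x) s' + inversions s')%N else 0.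

Definition levi_civita (s : seq nat) : int :=
  if uniq s then (-1) ^+ inversions s else 0.

(** The basis of Lambda^2 C^5.  Through the pairing with Lambda^3 C^5 by the
    volume form, it also indexes the coordinates of Lambda^3 C^5. *)
Definition pair5 (s : nat) : nat * nat :=
  nth (0, 0)%N [:: (0, 1); (0, 2); (0, 3); (0, 4); (1, 2); (1, 3); (1, 4);
                  (2, 3); (2, 4); (3, 4)]%N s.

(** The coefficient of e_a /\ e_s /\ e_t on the volume form: the entry (s, t) of
    the map e_a /\ _ from Lambda^2 C^5 to Lambda^3 C^5. *)
Definition wedge_sign (a s t : nat) : int :=
  levi_civita [:: a; (pair5 s).1; (pair5 s).2; (pair5 t).1; (pair5 t).2].

(** The coefficient of e_a /\ e_f on the basis vector s of Lambda^2 C^5. *)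
Definition wedge1_sign (a f s : nat) : int :=
  ((a, f) == pair5 s)%:Z - ((f, a) == pair5 s)%:Z.

(** The relation e_a /\ e_b = - e_b /\ e_a, seen on the composite maps
    C^5 -> Lambda^2 C^5 -> Lambda^3 C^5. *)
Lemma wedge_sign_antisym (a b f : 'I_5) (t : 'I_10) :
  \sum_(s < 10) wedge1_sign a f s * wedge_sign b s t =
  - (\sum_(s < 10) wedge1_sign b f s * wedge_sign a s t).
Proof.
pose c a b f t :=
  foldr (fun s z => wedge1_sign a f s * wedge_sign b s t + z) 0 (iota 0 10).
have cE a' b' f' t' :
    \sum_(s < 10) wedge1_sign a' f' s * wedge_sign b' s t' = c a' b' f' t'.
  by rewrite /c -(foldr_map _ (fun x y => x + y)) foldrE big_map
             -[iota 0 10]/(index_iota 0 10) big_mkord.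
have table : all (fun a => all (fun b => all (fun f => all (fun t =>
    c a b f t == - c b a f t) (iota 0 10)) (iota 0 5)) (iota 0 5)) (iota 0 5).
  by vm_compute.
rewrite !cE; apply/eqP.
have mem m (i : 'I_m) : (i : nat) \in iota 0 m by rewrite mem_iota /= ltn_ord.
by move/allP/(_ _ (mem _ a))/allP/(_ _ (mem _ b))/allP/(_ _ (mem _ f))
     /allP/(_ _ (mem _ t)) : table.
Qed.

Section WedgeMatrices.
Variable F : numFieldType.

Definition wedge2_mx (v : 'I_5 -> F) : 'M[F]_10 :=
  \matrix_(s, t) \sum_(a < 5) (wedge_sign a s t)%:~R * v a.

Definition wedge1_mx (v : 'I_5 -> F) : 'M[F]_(5, 10) :=
  \matrix_(f, s) \sum_(a < 5) (wedge1_sign a f s)%:~R * v a.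

(** v /\ v /\ _ = 0: the coefficient of v_a v_b is antisymmetric in a and b. *)
Lemma wedge_mx_complex v : wedge1_mx v *m wedge2_mx v = 0.
Proof.
apply/matrixP => f t; rewrite !mxE.
pose c a b : F := (\sum_(s < 10) wedge1_sign a f s * wedge_sign b s t)%:~R.
have -> : \sum_s wedge1_mx v f s * wedge2_mx v s t =
          \sum_(a < 5) \sum_(b < 5) v a * v b * c a b.
  under eq_bigr => s _ do rewrite !mxE mulr_suml.
  rewrite exchange_big; apply: eq_bigr => a _ /=.
  under eq_bigr => s _ do rewrite mulr_sumr.
  rewrite exchange_big; apply: eq_bigr => b _ /=.
  rewrite /c rmorph_sum mulr_sumr; apply: eq_bigr => s _ /=.
  by rewrite rmorphM /=; ring.
set S := LHS; have SN : S = - S.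
  rewrite {1}/S exchange_big -sumrN; apply: eq_bigr => a _ /=.
  rewrite -sumrN; apply: eq_bigr => b _ /=.
  by rewrite /c wedge_sign_antisym rmorphN mulrN (mulrC (v b)).
by apply/eqP; rewrite -[_ == _]orFb -(@mulrn_eq0 _ S 2) mulr2n {1}SN addNr.
Qed.

Lemma pair5_surj (f h : 'I_5) : f != h ->
  exists s : 'I_10,
    pair5 s = (f : nat, h : nat) \/ pair5 s = (h : nat, f : nat).
Proof.
have table : all (fun f => all (fun h => (f != h) ==> has (fun s =>
    (pair5 s == (f, h)) || (pair5 s == (h, f))) (iota 0 10))
    (iota 0 5)) (iota 0 5) by vm_compute.
have mem m (i : 'I_m) : (i : nat) \in iota 0 m by rewrite mem_iota /= ltn_ord.
move/allP/(_ _ (mem _ f))/allP/(_ _ (mem _ h)): table => /implyP/[apply].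
case/hasP => s; rewrite mem_iota /= => lt_s s_fh; exists (Ordinal lt_s).
by case/orP: s_fh => /eqP ->; [left | right].
Qed.

Lemma sum_indicator (n : nat) (x : 'I_n -> F) (f : 'I_n) :
  \sum_a (a == f)%:R * x a = x f.
Proof.
rewrite (bigD1 f) //= eqxx mul1r big1 ?addr0 // => a /negPf ->.
by rewrite mul0r.
Qed.

(** The coordinates of v /\ u are the 2 x 2 minors of v and u. *)
Lemma row_wedge1_mx (u : 'rV[F]_5) (v : 'I_5 -> F) (s : 'I_10) (f h : 'I_5) :
  pair5 s = (f : nat, h : nat) ->
  (u *m wedge1_mx v) 0 s = u 0 h * v f - u 0 f * v h.
Proof.
move=> sE; rewrite mxE.
have entryE g : wedge1_mx v g s = (g == h)%:R * v f - (g == f)%:R * v h.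
  rewrite mxE -(sum_indicator v f) -(sum_indicator v h) !mulr_sumr -sumrB.
  apply: eq_bigr => a _.
  rewrite /wedge1_sign sE !xpair_eqE !val_eqE rmorphB /=.
  rewrite mulrBl !mulrA -!natrM !mulnb.
  by rewrite [(g == f) && _]andbC [(g == h) && _]andbC andbC.
under eq_bigr => g _ do rewrite entryE mulrBr mulrCA [X in _ - X]mulrCA.
by rewrite sumrB !sum_indicator.
Qed.

(** If v is not 0, then v /\ u = 0 only for u on the line of v, so v /\ _ has
    rank 4 on C^5; its image lies in the kernel of v /\ _ on the ten-dimensional
    space Lambda^2 C^5. *)
Lemma wedge2_mx_rank v : (\rank (wedge2_mx v) <= 6)%N.
Proof.
have [v_eq0|] := eqVneq (\row_a v a) 0.
  have -> : wedge2_mx v = 0.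
    apply/matrixP => s t; rewrite !mxE big1 // => a _.
    by have /rowP/(_ a) := v_eq0; rewrite !mxE => ->; rewrite mulr0.
  by rewrite mxrank0.
move=> /rV0Pn[f]; rewrite mxE => vf_neq0.
have ker1 : (\rank (kermx (wedge1_mx v)) <= 1)%N.
  apply: leq_trans (rank_leq_row (\row_a v a)); apply: mxrankS.
  apply/row_subP => i; set u := row i _.
  have uv0 : u *m wedge1_mx v = 0 by rewrite -row_mul mulmx_ker row0.
  clearbody u.
  suff -> : u = (u 0 f / v f) *: \row_a v a by apply: scalemx_sub.
  apply/rowP => h; rewrite !mxE.
  have [<-|f_neq_h] := eqVneq f h; first by rewrite mulfVK.
  suff uh : u 0 h * v f = u 0 f * v h.
    by apply: (mulIf vf_neq0); rewrite uh mulrAC mulfVK.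
  have [s [sE|sE]] := pair5_surj f_neq_h;
    have := row_wedge1_mx u v sE; rewrite uv0 mxE => /esym/eqP;
    by rewrite subr_eq0 => /eqP.
move: (mulmx0_rank_max (wedge_mx_complex v)) ker1; rewrite mxrank_ker; lia.
Qed.

End WedgeMatrices.

(** * Koszul flattenings *)

Section KoszulFlattening.
Variables (F : numFieldType) (I J K : finType) (phi : nat -> seq I).
Implicit Type T : tensor3 F I J K.

(** The projection of the first factor to C^5 has for its a-th coordinate the
    sum of the coordinates listed in [phi a]. *)
Definition koszul T (r : 'I_10 * J) (c : 'I_10 * K) : F :=
  \sum_(a < 5) (wedge_sign a r.1 c.1)%:~R * \sum_(i <- phi a) T (i, r.2, c.2).

Section Minors.
Variables (Q : finType) (row : Q -> 'I_10 * J) (col : Q -> 'I_10 * K).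

Definition koszul_minor T : 'M[F]_#|Q| :=
  \matrix_(p, p') koszul T (row (enum_val p)) (col (enum_val p')).

Lemma koszul_minor_tens3 x y z :
  (\rank (koszul_minor (tens3 x y z)) <= 6)%N.
Proof.
pose v (a : 'I_5) := \sum_(i <- phi a) x i.
pose rowm : 'M[F]_(#|Q|, 10) :=
  \matrix_(p, s) (((row (enum_val p)).1 == s)%:R * y (row (enum_val p)).2).
pose colm : 'M[F]_(10, #|Q|) :=
  \matrix_(t, p) ((t == (col (enum_val p)).1)%:R * z (col (enum_val p)).2).
suff -> : koszul_minor (tens3 x y z) = rowm *m (wedge2_mx v *m colm).
  apply: leq_trans (mxrankM_maxr _ _) _; apply: leq_trans (mxrankM_maxl _ _) _.
  exact: wedge2_mx_rank.
apply/matrixP => p p'; rewrite !mxE.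
have inner s : (wedge2_mx v *m colm) s p' =
    wedge2_mx v s (col (enum_val p')).1 * z (col (enum_val p')).2.
  rewrite mxE (bigD1 (col (enum_val p')).1) //= big1 => [|t /negPf t_neq].
    by rewrite addr0 [colm _ _]mxE eqxx mul1r.
  by rewrite [colm _ _]mxE t_neq mul0r mulr0.
rewrite (bigD1 (row (enum_val p)).1) //= big1 => [|s /negPf s_neq]; last first.
  by rewrite [rowm _ _]mxE eq_sym s_neq !mul0r.
rewrite addr0 inner [rowm _ _]mxE eqxx mul1r mxE /koszul mulr_suml mulr_sumr.
apply: eq_bigr => a _; rewrite /tens3 /= -!mulr_suml -/(v a); ring.
Qed.

Lemma koszul_minor_rank T r :
  rank_decomp T r -> (\rank (koszul_minor T) <= 6 * r)%N.
Proof.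
move=> [x [y [z ->]]].
have -> : koszul_minor (\sum_(l < r) tens3 (x l) (y l) (z l)) =
          \sum_(l < r) koszul_minor (tens3 (x l) (y l) (z l)).
  apply/matrixP => p p'; rewrite summxE mxE /koszul.
  under eq_bigr => a _.
    under eq_bigr => i _ do rewrite sum_tensor3E.
    rewrite exchange_big mulr_sumr /=; over.
  by rewrite exchange_big; apply: eq_bigr => l _; rewrite mxE.
rewrite -[X in (6 * X)%N]card_ord mulnC -sum_nat_const.
elim/big_ind2: _ => [|m A m' B le_m le_m'|l _]; first by rewrite mxrank0.
- by apply: leq_trans (mxrank_add _ _) _; apply: leq_add.
- exact: koszul_minor_tens3.
Qed.

Lemma koszul_minor_cvg (u : nat -> tensor3 F I J K) T :
  {ptws, u @ \oo --> T} ->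
  \det (koszul_minor (u n)) @[n --> \oo] --> \det (koszul_minor T).
Proof.
move=> uT.
have u_cvg p : u n p @[n --> \oo] --> T p.
  by move/ptws_cvgP: uT; apply.
have sum_cvg L (s : seq L) (f : L -> nat -> F) (l : L -> F) :
    (forall i, f i n @[n --> \oo] --> l i) ->
    \sum_(i <- s) f i n @[n --> \oo] --> \sum_(i <- s) l i.
  by move=> fl; apply: cvg_big => // ; exact: add_continuous.
have prod_cvg L (s : seq L) (f : L -> nat -> F) (l : L -> F) :
    (forall i, f i n @[n --> \oo] --> l i) ->
    \prod_(i <- s) f i n @[n --> \oo] --> \prod_(i <- s) l i.
  by move=> fl; apply: cvg_big => // ; exact: mul_continuous.
have koszul_cvg r c : koszul (u n) r c @[n --> \oo] --> koszul T r c.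
  apply: (sum_cvg _ _ (fun a n => _)) => a; apply: cvgM; first exact: cvg_cst.
  by apply: (sum_cvg _ _ (fun i n => _)) => i; apply: u_cvg.
have minor_cvg i j :
    koszul_minor (u n) i j @[n --> \oo] --> koszul_minor T i j.
  rewrite mxE (_ : (fun n => _) = (fun n => koszul (u n) (row (enum_val i))
    (col (enum_val j)))); first exact: koszul_cvg.
  by apply/funext => n; rewrite mxE.
apply: (sum_cvg _ _ (fun s n => _)) => s; apply: cvgM; first exact: cvg_cst.
by apply: (prod_cvg _ _ (fun i n => _)) => i; apply: minor_cvg.
Qed.

(** The determinant is continuous in the tensor and vanishes on all tensors
    whose flattening has rank less than the size of the minor. *)
Lemma koszul_minor_border_rank T r :
  limit_of_rank_le T r -> \det (koszul_minor T) != 0 -> (#|Q| <= 6 * r)%N.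
Proof.
move=> [u [u_rank uT]] detT; rewrite leqNgt; apply/negP => lt_r.
have det0 n : \det (koszul_minor (u n)) = 0.
  apply/eqP; apply: contraTT lt_r => det_neq0; rewrite -leqNgt.
  have : koszul_minor (u n) \in unitmx by rewrite unitmxE unitfE.
  rewrite -row_free_unit => /eqP <-.
  move: (u_rank n); rewrite /tensor_rank; case: ex_minnP.
  move=> m /asboolP dec _ le_m.
  apply: leq_trans (koszul_minor_rank dec) _.
  by rewrite leq_mul2l le_m orbT.
case/negP: detT; apply/eqP.
have cvg0 := koszul_minor_cvg uT; rewrite (funext det0) in cvg0.
exact: (cvg_unique _ cvg0 (cvg_cst _)).
Qed.
End Minors.

End KoszulFlattening.

(** * The flattening of the square of the little Coppersmith-Winograd tensor *)

Definition cw_entry (i j k : nat) : bool :=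
  [|| [&& i == 0, j == k & k != 0], [&& j == 0, i == k & k != 0]
    | [&& k == 0, i == j & j != 0]]%N.

Lemma TcwE (F : numFieldType) (q : nat) (i j k : 'I_q.+1) :
  Tcw F q (i, j, k) = (cw_entry i j k)%:R.
Proof.
rewrite /Tcw sum_tensor3E.
have pair_sum (a b c : 'I_q.+1) :
    \sum_(l < q.+1 | l != ord0) (a == ord0)%:R * (b == l)%:R * (c == l)%:R
    = [&& a == 0%N :> nat, b == c :> nat & c != 0%N :> nat]%:R :> F.
  rewrite big_mkcond (bigD1 c) //= big1 => [|l /negPf l_neq_c]; last first.
    by rewrite (eq_sym c) l_neq_c mulr0 if_same.
  rewrite eqxx mulr1 addr0 -!val_eqE /=.
  by case: (_ == 0%N); case: (_ == 0%N); case: eqP;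
    rewrite ?(mulr0, mul0r, mulr1).
rewrite /tens3 /basisv /= !big_split /= !pair_sum.
have -> : \sum_(l < q.+1 | l != ord0) (i == l)%:R * (j == ord0)%:R * (k == l)%:R
    = [&& j == 0%N :> nat, i == k :> nat & k != 0%N :> nat]%:R :> F.
  by rewrite -pair_sum; apply: eq_bigr => l _; rewrite (mulrC (i == l)%:R).
have -> : \sum_(l < q.+1 | l != ord0) (i == l)%:R * (j == l)%:R * (k == ord0)%:R
    = [&& k == 0%N :> nat, i == j :> nat & j != 0%N :> nat]%:R :> F.
  by rewrite -pair_sum; apply: eq_bigr => l _; rewrite mulrC mulrA.
rewrite /cw_entry.
case: (i : nat) => [|i']; case: (j : nat) => [|j']; case: (k : nat) => [|k'];
  rewrite ?eqSS //= ?andbT ?andbF ?orbF ?add0r ?addr0 //.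
Qed.

(** The five combinations of slices M_i (x) M_j, all with coefficients 1, as
    lists of pairs (i, j). *)
Definition slice_support (a : nat) : seq (nat * nat) :=
  nth [::] [:: [:: (0, 0)]; [:: (0, 1); (1, 0); (1, 3)]; [:: (0, 2); (2, 0)];
    [:: (0, 3); (3, 0); (3, 2)]; [:: (1, 1); (3, 3)]]%N a.

(** The entries of the flattening are integers and depend only on the values of
    the indices; computing them in [int] makes the pivots checkable by
    evaluation. *)
Definition cw2_koszul (r c : nat * (nat * nat)) : int :=
  foldr (fun a z => wedge_sign a r.1 c.1 *
    (count (fun i => cw_entry i.1 r.2.1 c.2.1 && cw_entry i.2 r.2.2 c.2.2)
       (slice_support a))%:Z + z) 0 (iota 0 5).

(** Positions ((s, (j, j')), (t, (l, l'))) of the diagonal of a triangular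
    submatrix for q = 3, with row s (x) b_j (x) b_j' and column
    t (x) c_l (x) c_l'.  They arise by repeatedly picking a row or a column of
    the 160 x 160 flattening in which only one nonzero entry remains and
    deleting the row and the column of that entry; rows so found are
    listed from the front, columns from the back.  This elimination exhausts
    the matrix, whose rank is thus exactly 146; at least 145 are needed. *)
Definition small_pivots : seq ((nat * (nat * nat)) * (nat * (nat * nat))) :=
  [:: ((9,(0,0)),(1,(1,3))); ((6,(1,0)),(2,(1,2))); ((9,(3,3)),(4,(3,3)));
      ((8,(2,2)),(5,(2,2))); ((7,(0,2)),(3,(1,2))); ((5,(1,0)),(1,(0,1)));
      ((7,(2,0)),(3,(2,1))); ((5,(0,1)),(1,(1,0))); ((9,(0,3)),(0,(2,3)));
      ((8,(2,0)),(2,(2,1))); ((6,(0,1)),(1,(3,1))); ((9,(3,0)),(0,(3,2)));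
      ((8,(0,2)),(0,(3,0))); ((9,(3,2)),(4,(3,2))); ((3,(0,0)),(7,(1,3)));
      ((9,(1,1)),(4,(1,1))); ((2,(0,0)),(8,(1,3))); ((7,(3,2)),(6,(3,2)));
      ((7,(2,3)),(6,(2,3))); ((1,(2,0)),(9,(2,1))); ((7,(2,2)),(6,(2,2)));
      ((2,(0,2)),(8,(1,2))); ((5,(1,2)),(3,(1,0))); ((4,(1,3)),(9,(1,3)));
      ((7,(0,3)),(3,(1,3))); ((4,(1,0)),(2,(0,1))); ((6,(2,1)),(7,(2,1)));
      ((3,(2,0)),(4,(2,3))); ((9,(2,3)),(0,(0,3))); ((8,(3,3)),(5,(3,3)));
      ((1,(0,0)),(5,(1,1))); ((8,(1,1)),(2,(1,0))); ((6,(1,2)),(7,(1,2)));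
      ((3,(0,2)),(4,(3,0))); ((2,(0,3)),(8,(1,0))); ((3,(3,3)),(4,(0,3)));
      ((2,(3,0)),(8,(3,1))); ((0,(0,1)),(7,(1,0))); ((3,(1,1)),(7,(0,1)));
      ((0,(1,0)),(9,(1,2))); ((1,(0,2)),(6,(3,0))); ((4,(0,1)),(3,(3,1)));
      ((6,(1,1)),(7,(1,1))); ((5,(0,2)),(3,(2,2))); ((4,(2,0)),(3,(2,3)));
      ((5,(0,3)),(1,(3,0))); ((4,(2,2)),(9,(2,2))); ((2,(3,3)),(4,(0,0)));
      ((2,(1,1)),(8,(0,1))); ((2,(2,3)),(6,(0,3))); ((1,(3,3)),(5,(0,0)));
      ((2,(3,1)),(8,(3,0))); ((0,(0,2)),(8,(3,2))); ((0,(0,0)),(7,(3,3)));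
      ((6,(3,3)),(1,(0,3))); ((5,(3,0)),(3,(3,2))); ((4,(0,2)),(3,(3,0)));
      ((1,(1,2)),(9,(0,2))); ((0,(2,2)),(9,(2,0))); ((0,(2,1)),(9,(0,1)));
      ((1,(1,1)),(9,(1,0))); ((2,(1,2)),(8,(0,2))); ((0,(1,1)),(7,(0,0)));
      ((0,(3,3)),(8,(0,3))); ((2,(1,3)),(8,(0,0))); ((0,(3,2)),(9,(3,0)));
      ((1,(3,1)),(6,(0,1))); ((2,(2,1)),(8,(2,0))); ((0,(2,3)),(9,(0,3)));
      ((1,(1,3)),(9,(0,0))); ((1,(2,3)),(6,(2,0))); ((2,(2,2)),(6,(0,2)));
      ((1,(3,2)),(6,(0,0))); ((7,(3,1)),(6,(3,1))); ((0,(2,0)),(8,(2,3)));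
      ((5,(2,3)),(3,(0,3))); ((3,(3,1)),(4,(0,1))); ((7,(1,2)),(6,(1,2)));
      ((2,(1,0)),(8,(1,1))); ((5,(1,1)),(1,(0,0))); ((5,(3,3)),(8,(3,3)));
      ((0,(0,3)),(9,(2,3))); ((4,(2,3)),(3,(2,0))); ((7,(2,1)),(6,(2,1)));
      ((2,(0,1)),(4,(1,0))); ((3,(1,3)),(7,(0,3))); ((0,(3,0)),(9,(3,2)));
      ((4,(3,2)),(3,(0,0))); ((7,(1,3)),(6,(1,3))); ((3,(2,1)),(5,(0,1)));
      ((1,(1,0)),(9,(1,1))); ((1,(0,1)),(5,(1,0))); ((3,(1,2)),(7,(0,2)));
      ((3,(2,2)),(5,(0,2))); ((4,(1,1)),(2,(0,0))); ((4,(3,3)),(9,(3,3)));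
      ((5,(2,2)),(8,(2,2))); ((9,(1,3)),(4,(1,3))); ((3,(1,0)),(5,(1,2)));
      ((8,(1,2)),(2,(0,2))); ((9,(3,1)),(4,(3,1))); ((3,(0,1)),(5,(2,1)));
      ((8,(2,1)),(2,(2,0))); ((6,(2,2)),(7,(2,2))); ((6,(0,0)),(1,(3,2)));
      ((6,(0,2)),(2,(2,2))); ((6,(2,0)),(1,(2,3))); ((3,(2,3)),(5,(0,3)));
      ((2,(2,0)),(8,(2,1))); ((5,(2,1)),(3,(0,1))); ((4,(3,1)),(9,(3,1)));
      ((1,(3,0)),(6,(3,3))); ((7,(3,3)),(0,(0,0))); ((7,(1,1)),(6,(1,1)));
      ((8,(0,0)),(2,(1,3))); ((8,(0,3)),(0,(3,3))); ((7,(0,0)),(0,(1,1)));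
      ((6,(0,3)),(1,(3,3))); ((6,(3,0)),(1,(0,2))); ((6,(3,2)),(2,(3,0)));
      ((4,(0,3)),(3,(3,3))); ((4,(3,0)),(2,(0,3))); ((8,(1,3)),(0,(1,0)));
      ((7,(0,1)),(3,(1,1))); ((7,(1,0)),(0,(0,1))); ((8,(3,1)),(5,(3,1)));
      ((4,(0,0)),(2,(1,1))); ((8,(1,0)),(0,(1,3))); ((6,(3,1)),(7,(3,1)));
      ((1,(0,3)),(5,(3,0))); ((3,(3,2)),(4,(0,2))); ((3,(3,0)),(5,(3,2)));
      ((8,(3,2)),(0,(0,2))); ((8,(3,0)),(2,(3,1))); ((8,(0,1)),(0,(3,1)));
      ((9,(1,2)),(4,(1,2))); ((6,(2,3)),(1,(2,0))); ((9,(2,1)),(4,(2,1)));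
      ((3,(0,3)),(5,(2,3))); ((8,(2,3)),(0,(2,0))); ((9,(2,2)),(4,(2,2)));
      ((5,(0,0)),(1,(1,1))); ((9,(1,0)),(0,(1,2))); ((9,(0,1)),(0,(2,1)));
      ((9,(2,0)),(0,(2,2))); ((9,(0,2)),(1,(1,2)))].

(** The same for the blocks in which one of the two coordinates is fixed and at
    least 4, with positions ((s, j), (t, l)).  The chosen combinations restrict
    to M_0, M_1, M_2, M_3, 0 on either side, so that one list serves both. *)
Definition side_pivots : seq ((nat * nat) * (nat * nat)) :=
  [:: ((9,3),(4,3)); ((8,2),(5,2)); ((3,0),(7,1)); ((7,3),(6,3));
      ((1,0),(9,1)); ((7,2),(6,2)); ((2,0),(8,1)); ((5,3),(8,3));
      ((0,0),(9,2)); ((2,2),(6,0)); ((2,1),(8,0)); ((1,1),(9,0));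
      ((3,1),(7,0)); ((3,2),(5,0)); ((3,3),(4,0)); ((4,0),(3,3));
      ((4,3),(3,0)); ((5,2),(8,2)); ((5,0),(3,2)); ((6,0),(2,2));
      ((7,1),(6,1)); ((7,0),(3,1)); ((6,2),(2,0)); ((8,1),(5,1));
      ((8,0),(2,1)); ((6,3),(1,0)); ((9,1),(4,1)); ((8,3),(0,0));
      ((9,2),(4,2)); ((9,0),(1,1))].

(** The blocks in which both coordinates are fixed and at least 4: only the
    first combination contributes, and e_0 /\ _ pairs complementary basis
    vectors s and t of Lambda^2 <e_1, ..., e_4>. *)
Definition corner_pivots : seq (nat * nat) :=
  [:: (4, 9); (5, 8); (6, 7); (7, 6); (8, 5); (9, 4)]%N.

(** In a pair b of booleans, true marks a coordinate that is at least 4; the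
    entries do not depend on its value, and 4 stands for any such value. *)
Definition pivots (b : bool * bool) :
    seq ((nat * (nat * nat)) * (nat * (nat * nat))) :=
  match b with
  | (false, false) => small_pivots
  | (false, true) =>
      [seq ((p.1.1, (p.1.2, 4)), (p.2.1, (p.2.2, 4)))%N | p <- side_pivots]
  | (true, false) =>
      [seq ((p.1.1, (4, p.1.2)), (p.2.1, (4, p.2.2)))%N | p <- side_pivots]
  | (true, true) => [seq ((p.1, (4, 4)), (p.2, (4, 4)))%N | p <- corner_pivots]
  end.

Definition in_block (b : bool * bool) (r : nat * (nat * nat)) : bool :=
  [&& r.1 < 10, (if b.1 then r.2.1 == 4 else r.2.1 < 4)
    & (if b.2 then r.2.2 == 4 else r.2.2 < 4)]%N.

Lemma pivotsP b :
  [/\ all (fun p => in_block b p.1 && in_block b p.2) (pivots b),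
      all (fun p => cw2_koszul p.1 p.2 != 0) (pivots b)
    & pairwise (fun p p' => cw2_koszul p.1 p'.2 == 0) (pivots b)].
Proof. by case: b => [[] []]; split; vm_compute. Qed.

Section CwSquare.
Variables (F : numFieldType) (k : nat).

Definition cw2_slices (a : nat) : seq ('I_k.+4 * 'I_k.+4) :=
  [seq (inord i.1, inord i.2) | i <- slice_support a].

Lemma slice_support_lt4 a i :
  i \in slice_support a -> (i.1 < 4)%N /\ (i.2 < 4)%N.
Proof.
move=> ai; apply/andP; move: i ai; apply/allP.
by do 5! [case: a => [|a] //]; rewrite /slice_support nth_default.
Qed.

Definition cw2_index (r : 'I_10 * ('I_k.+4 * 'I_k.+4)) : nat * (nat * nat) :=
  (r.1 : nat, (r.2.1 : nat, r.2.2 : nat)).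

Lemma koszul_cw2E r c :
  koszul cw2_slices (kron (Tcw F k.+3) (Tcw F k.+3)) r c =
  (cw2_koszul (cw2_index r) (cw2_index c))%:~R.
Proof.
rewrite /cw2_koszul -(foldr_map _ (fun x y => x + y)) foldrE big_map.
rewrite -[iota 0 5]/(index_iota 0 5) big_mkord rmorph_sum /=.
apply: eq_bigr => a _; rewrite rmorphM /=; congr (_ * _).
rewrite big_map; have := @slice_support_lt4 a.
elim: (slice_support a) => [|i s IHs] lt4; first by rewrite big_nil.
rewrite big_cons {}IHs => [|j sj]; last by apply: lt4; rewrite inE sj orbT.
have [lt1 lt2] := lt4 i (mem_head _ _).
rewrite /kron /= !TcwE !inordK ?(leq_trans lt1) ?(leq_trans lt2) //.
by rewrite -natrM mulnb PoszD intrD.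
Qed.

(** The blocks are indexed by pairs of options: [Some s] for the fixed
    coordinate 4 + s, [None] for a coordinate that ranges over 0, ..., 3. *)
Definition spread (o : option 'I_k) (j : nat) : nat :=
  if o is Some s then (4 + s)%N else j.

Definition block_shape (b : option 'I_k * option 'I_k) : bool * bool :=
  (isSome b.1, isSome b.2).

Definition spread_index (b : option 'I_k * option 'I_k)
    (r : nat * (nat * nat)) : nat * (nat * nat) :=
  (r.1, (spread b.1 r.2.1, spread b.2 r.2.2)).

Lemma cw_entry_spread (o : option 'I_k) (i j l : nat) :
  (if isSome o then j == 4 else j < 4)%N ->
  (if isSome o then l == 4 else l < 4)%N ->
  cw_entry i (spread o j) (spread o l) = cw_entry i j l.
Proof.
case: o => [s|] //= /eqP-> /eqP->.
by rewrite /cw_entry !eqxx /=; case: (i == 0)%N.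
Qed.

(** M_0, ..., M_3 are block diagonal for the decomposition of the coordinates
    into {0, 1, 2, 3}, {4}, {5}, and so on. *)
Lemma cw_entry_spread_neq (o o' : option 'I_k) (i j l : nat) :
  o != o' -> (i < 4)%N ->
  (if isSome o then j == 4 else j < 4)%N ->
  (if isSome o' then l == 4 else l < 4)%N ->
  cw_entry i (spread o j) (spread o' l) = false.
Proof.
rewrite /cw_entry => + i4.
case: o o' => [s|] [s'|] //= neq oj ol; try lia.
have {neq} : (s : nat) != s' by [].
lia.
Qed.

Lemma cw2_koszul_spread b r c :
  in_block (block_shape b) r -> in_block (block_shape b) c ->
  cw2_koszul (spread_index b r) (spread_index b c) = cw2_koszul r c.
Proof.
move=> /and3P[_ r1 r2] /and3P[_ c1 c2]; congr (foldr _ _ _).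
apply/funext => a; apply/funext => z; congr (_ * Posz _ + _).
by apply: eq_count => i /=; rewrite !cw_entry_spread.
Qed.

Lemma cw2_koszul_spread_neq b b' r c : b != b' ->
  in_block (block_shape b) r -> in_block (block_shape b') c ->
  cw2_koszul (spread_index b r) (spread_index b' c) = 0.
Proof.
move=> bb' /and3P[_ r1 r2] /and3P[_ c1 c2].
rewrite -[RHS]/(foldr (fun _ z => z) 0 (iota 0 5)); congr (foldr _ _ _).
apply/funext => a; apply/funext => z.
rewrite (eq_in_count (a2 := pred0)) ?count_pred0 ?mulr0 ?add0r // => i.
case/slice_support_lt4 => i1 i2 /=.
have [b1|b1] := eqVneq b.1 b'.1; last by rewrite (cw_entry_spread_neq b1).
rewrite [X in _ && X]cw_entry_spread_neq ?andbF //.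
by apply: contra bb' => /eqP b2; rewrite [b]surjective_pairing b1 b2
  -surjective_pairing.
Qed.

(** One copy of the pivots for each block: a sum of products rather than a
    dependent sum over the blocks, so that its cardinal is immediate. *)
Definition pivot_type : finType :=
  ('I_(size small_pivots) + 'I_(size side_pivots) * 'I_k
   + 'I_(size side_pivots) * 'I_k
   + 'I_(size corner_pivots) * ('I_k * 'I_k))%type.

Definition pivot_block (x : pivot_type) : option 'I_k * option 'I_k :=
  match x with
  | inl (inl (inl _)) => (None, None)
  | inl (inl (inr p)) => (None, Some p.2)
  | inl (inr p) => (Some p.2, None)
  | inr p => (Some p.2.1, Some p.2.2)
  end.

Definition pivot_rank (x : pivot_type) : nat :=
  match x with
  | inl (inl (inl i)) => i
  | inl (inl (inr p)) => p.1
  | inl (inr p) => p.1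
  | inr p => p.1
  end.

Lemma pivot_inj x y :
  pivot_block x = pivot_block y -> pivot_rank x = pivot_rank y -> x = y.
Proof.
case: x y => [[[i|[i s]]|[i s]]|[i [s t]]] [[[j|[j u]]|[j u]]|[j [u w]]] //=.
- by move=> _ /ord_inj ->.
- by case=> -> /ord_inj ->.
- by case=> -> /ord_inj ->.
- by case=> -> -> /ord_inj ->.
Qed.

Definition pivot_entry (x : pivot_type) :=
  nth ((0, (0, 0)), (0, (0, 0)))%N (pivots (block_shape (pivot_block x)))
    (pivot_rank x).

Lemma pivot_rank_lt x :
  (pivot_rank x < size (pivots (block_shape (pivot_block x))))%N.
Proof.
by case: x => [[[i|[i s]]|[i s]]|[i [s t]]] /=; rewrite ?size_map ltn_ord.
Qed.

Definition cw2_ord (r : nat * (nat * nat)) : 'I_10 * ('I_k.+4 * 'I_k.+4) :=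
  (inord r.1, (inord r.2.1, inord r.2.2)).

Definition pivot_row x :=
  cw2_ord (spread_index (pivot_block x) (pivot_entry x).1).

Definition pivot_col x :=
  cw2_ord (spread_index (pivot_block x) (pivot_entry x).2).

Lemma cw2_ordK b r : in_block (block_shape b) r ->
  cw2_index (cw2_ord (spread_index b r)) = spread_index b r.
Proof.
case: b r => [b1 b2] [s [j1 j2]] /and3P[] /= s10 j1P j2P.
have spread_lt (o : option 'I_k) (j : nat) :
    (if isSome o then j == 4 else j < 4)%N -> (spread o j < k.+4)%N.
  by case: o => [u|] /= j4; [have := ltn_ord u | idtac]; lia.
by rewrite /cw2_index /= !inordK ?spread_lt.
Qed.

Lemma pivot_in_block x :
  in_block (block_shape (pivot_block x)) (pivot_entry x).1 /\
  in_block (block_shape (pivot_block x)) (pivot_entry x).2.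
Proof.
have [/all_nthP blk _ _] := pivotsP (block_shape (pivot_block x)).
exact/andP/(blk _ _ (pivot_rank_lt x)).
Qed.

(** Entries between different blocks vanish, so the position of the pivots
    within their blocks is a triangular order on all of them. *)
Lemma cw2_minor_neq0 :
  \det (koszul_minor cw2_slices pivot_row pivot_col
          (kron (Tcw F k.+3) (Tcw F k.+3))) != 0.
Proof.
have entryE x y : koszul cw2_slices (kron (Tcw F k.+3) (Tcw F k.+3))
    (pivot_row x) (pivot_col y) =
    (cw2_koszul (spread_index (pivot_block x) (pivot_entry x).1)
                (spread_index (pivot_block y) (pivot_entry y).2))%:~R.
  have [[xr _] [_ yc]] := (pivot_in_block x, pivot_in_block y).
  by rewrite koszul_cw2E !cw2_ordK.
apply: (triangular_det_neq0 (ord := pivot_rank)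
  (M := fun x y => koszul _ _ (pivot_row x) (pivot_col y)))
  => [x|x y xy le_xy]; rewrite entryE.
  rewrite intr_eq0; have [xr xc] := pivot_in_block x.
  rewrite cw2_koszul_spread //.
  have [_ /all_nthP diag _] := pivotsP (block_shape (pivot_block x)).
  exact: diag (pivot_rank_lt x).
have [[xr _] [_ yc]] := (pivot_in_block x, pivot_in_block y).
have [bxy|bxy] := eqVneq (pivot_block x) (pivot_block y); last first.
  by rewrite cw2_koszul_spread_neq.
rewrite /pivot_entry -bxy in yc *.
rewrite cw2_koszul_spread //; apply/eqP; rewrite intr_eq0.
have [_ _ /pairwiseP upper] := pivotsP (block_shape (pivot_block x)).
apply: upper; rewrite ?inE ?pivot_rank_lt //.
  by rewrite bxy pivot_rank_lt.
rewrite ltn_neqAle le_xy andbT; apply: contra xy => /eqP rxy.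
exact/eqP/pivot_inj.
Qed.

Lemma card_pivot_type : #|pivot_type| = (146 + 60 * k + 6 * (k * k))%N.
Proof. by rewrite !card_sum !card_prod !card_ord /=; lia. Qed.

Lemma cw2_border_rank_ge r :
  limit_of_rank_le (kron (Tcw F k.+3) (Tcw F k.+3)) r -> ((k + 5) ^ 2 <= r)%N.
Proof.
move=> /koszul_minor_border_rank/(_ cw2_minor_neq0).
(* 146 + 60 k + 6 k^2 <= 6 r excludes r <= (k + 5)^2 - 1 = k^2 + 10 k + 24. *)
rewrite card_pivot_type; nia.
Qed.

End CwSquare.

(** * The upper bound *)

Section UpperBound.
Variable F : numFieldType.

Lemma rank_decomp_sum (I J K L : finType) (x : L -> I -> F) (y : L -> J -> F)
    (z : L -> K -> F) :
  rank_decomp (\sum_l tens3 (x l) (y l) (z l)) #|L|.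
Proof.
exists (fun i => x (enum_val i)), (fun i => y (enum_val i)),
  (fun i => z (enum_val i)).
by rewrite (reindex (@enum_val L L)) //; apply: onW_bij; apply: enum_val_bij.
Qed.

Lemma tensor_rank_le (I J K : finType) (T : tensor3 F I J K) r :
  rank_decomp T r -> (tensor_rank T <= r)%N.
Proof.
by rewrite /tensor_rank; case: ex_minnP => m _ m_min decT; apply/m_min/asboolP.
Qed.

Lemma rank_decomp_kron (I J K I' J' K' : finType) (T : tensor3 F I J K)
    (S : tensor3 F I' J' K') r s :
  rank_decomp T r -> rank_decomp S s -> rank_decomp (kron T S) (r * s).
Proof.
move=> [x [y [z ->]]] [x' [y' [z' ->]]].
rewrite -[r in (r * s)%N]card_ord -[s in (_ * s)%N]card_ord -card_prod.
suff -> : kron (\sum_(l < r) tens3 (x l) (y l) (z l))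
               (\sum_(m < s) tens3 (x' m) (y' m) (z' m)) =
  \sum_(lm : 'I_r * 'I_s) tens3 (tensv (x lm.1) (x' lm.2))
     (tensv (y lm.1) (y' lm.2)) (tensv (z lm.1) (z' lm.2)).
  exact: rank_decomp_sum.
apply/funext => p; rewrite /kron !sum_tensor3E big_distrlr /= pair_big /=.
by apply: eq_bigr => lm _; rewrite -kron_tens3.
Qed.

Lemma rank_decompD (I J K : finType) (T S : tensor3 F I J K) r s :
  rank_decomp T r -> rank_decomp S s -> rank_decomp (T + S) (r + s).
Proof.
move=> [x [y [z ->]]] [x' [y' [z' ->]]].
pose glue X (f : 'I_r -> X -> F) (g : 'I_s -> X -> F) (l : 'I_(r + s)) :=
  match fintype.split l with inl i => f i | inr i => g i end.
have glueL X f g l : @glue X f g (lshift s l) = f l.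
  by rewrite /glue (unsplitK (inl l)).
have glueR X f g l : @glue X f g (rshift r l) = g l.
  by rewrite /glue (unsplitK (inr l)).
exists (glue _ x x'), (glue _ y y'), (glue _ z z').
rewrite big_split_ord /=; congr (_ + _).
  by apply: eq_bigr => l _; rewrite !glueL.
by apply: eq_bigr => l _; rewrite !glueR.
Qed.

Section Degeneration.
Variable q : nat.
Let e (j : 'I_q.+1) : 'I_q.+1 -> F := basisv F j.
Let sigma : 'I_q.+1 -> F := fun a => \sum_(l < q.+1 | l != ord0) e l a.

Let u (t : F) (j a : 'I_q.+1) : F := e ord0 a + t * e j a.
Let w (t : F) (a : 'I_q.+1) : F := e ord0 a + t ^+ 2 * sigma a.

(** The orders t^-3, t^-2 and t^-1 cancel, and the order 0 is T_cw,q. *)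
Definition cw_degeneration (t : F) : tensor3 F 'I_q.+1 'I_q.+1 'I_q.+1 :=
  \sum_(j < q) tens3 (fun a => t ^- 2 * u t (lift ord0 j) a)
                     (u t (lift ord0 j)) (u t (lift ord0 j))
  + tens3 (fun a => - t ^- 3 * w t a) (w t) (w t)
  + tens3 (fun a => (t ^- 3 - q%:R * t ^- 2) * e ord0 a) (e ord0) (e ord0).

Lemma cw_degeneration_rank t : rank_decomp (cw_degeneration t) (q + 2).
Proof.
have tens_rank1 x y z : rank_decomp
    (tens3 x y z : tensor3 F 'I_q.+1 'I_q.+1 'I_q.+1) 1.
  by exists (fun=> x), (fun=> y), (fun=> z); rewrite big_ord1.
rewrite -[2%N]/(1 + 1)%N addnA.
apply: rank_decompD; first apply: rank_decompD; try exact: tens_rank1.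
by rewrite -[X in rank_decomp _ X]card_ord; apply: rank_decomp_sum.
Qed.

Lemma cw_degenerationE (t : F) (a b c : 'I_q.+1) : t != 0 ->
  cw_degeneration t (a, b, c) =
    Tcw F q (a, b, c)
    + t * (\sum_(l < q.+1 | l != ord0) e l a * e l b * e l c
           - (sigma a * sigma b * e ord0 c + sigma a * e ord0 b * sigma c
              + e ord0 a * sigma b * sigma c))
    - t ^+ 3 * (sigma a * sigma b * sigma c).
Proof.
move=> t_neq0; rewrite /cw_degeneration.
rewrite !fctE sum_tensor3E /tens3 /=.
have -> : \sum_(j < q) t ^- 2 * u t (lift ord0 j) a * u t (lift ord0 j) b
            * u t (lift ord0 j) c
        = t ^- 2 * \sum_(l < q.+1 | l != ord0) u t l a * u t l b * u t l c.
  rewrite [in RHS]big_mkcond [in RHS]big_ord_recl eqxx /= add0r mulr_sumr.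
  by apply: eq_bigr => j _; rewrite !mulrA.
have -> : \sum_(l < q.+1 | l != ord0) u t l a * u t l b * u t l c =
    q%:R * (e ord0 a * e ord0 b * e ord0 c)
    + t * (sigma a * e ord0 b * e ord0 c + e ord0 a * sigma b * e ord0 c
           + e ord0 a * e ord0 b * sigma c)
    + t ^+ 2 * Tcw F q (a, b, c)
    + t ^+ 3 * \sum_(l < q.+1 | l != ord0) e l a * e l b * e l c.
  have -> : q%:R * (e ord0 a * e ord0 b * e ord0 c) =
      \sum_(l < q.+1 | l != ord0) (e ord0 a * e ord0 b * e ord0 c).
    by rewrite sumr_const cardC1 card_ord mulr_natl.
  rewrite /sigma /Tcw sum_tensor3E !mulrDr.
  rewrite !(mulr_suml, mulr_sumr) -!big_split /=.
  by apply: eq_bigr => l _; rewrite /u /tens3 /e !fctE /=; ring.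
rewrite /w; field.
exact: t_neq0.
Qed.

Lemma cw_degeneration_cvg (t : nat -> F) (p : 'I_q.+1 * 'I_q.+1 * 'I_q.+1) :
  (forall n, t n != 0) -> t n @[n --> \oo] --> 0 ->
  cw_degeneration (t n) p @[n --> \oo] --> Tcw F q p.
Proof.
case: p => [[a b] c] t_neq0 t0.
rewrite (funext (fun n => cw_degenerationE a b c (t_neq0 n))).
have t3 : t n ^+ 3 @[n --> \oo] --> 0.
  rewrite -[X in _ --> X](mulr0 0) -{2}[0](mulr0 0).
  exact: cvgM t0 (cvgM t0 t0).
set err1 := \sum_(_ < _ | _) _ - _; set err3 := sigma a * _ * _.
suff : Tcw F q (a, b, c) + t n * err1 - t n ^+ 3 * err3 @[n --> \oo] -->
       Tcw F q (a, b, c) + 0 * err1 - 0 * err3.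
  by rewrite !mul0r addr0 subr0.
apply: cvgB; last by apply: cvgM => //; exact: cvg_cst.
by apply: cvgD; [exact: cvg_cst | apply: cvgM => //; exact: cvg_cst].
Qed.

Lemma limit_of_rank_le_cw2 (t : nat -> F) :
  (forall n, t n != 0) -> t n @[n --> \oo] --> 0 ->
  limit_of_rank_le (kron (Tcw F q) (Tcw F q)) ((q + 2) ^ 2).
Proof.
move=> t_neq0 t0.
exists (fun n => kron (cw_degeneration (t n)) (cw_degeneration (t n))); split.
  move=> n; apply: tensor_rank_le; rewrite -mulnn.
  by apply: rank_decomp_kron; apply: cw_degeneration_rank.
apply/ptws_cvgP => p; rewrite /kron.
by apply: cvgM; apply: cw_degeneration_cvg.
Qed.
End Degeneration.
End UpperBound.

(** A positive complex number is real, so the Archimedean property of R makes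
    1 / (n + 1) a null sequence. *)
Lemma Cplx_null_seq (R : realType) : exists2 t : nat -> Cplx R,
  (forall n, t n != 0) & t n @[n --> \oo] --> 0.
Proof.
exists (fun n => (n.+1%:R)^-1) => [n|]; first by rewrite invr_neq0 ?pnatr_eq0.
apply/cvgr0Pnorm_lt => eps; case: eps => a b /=.
rewrite ltcE /= => /andP[/eqP -> a_gt0].
have [N _ invN] := near_infty_natSinv_lt (PosNum a_gt0).
exists N => // n /invN /= lt_a.
rewrite ger0_norm ?invr_ge0 ?ler0n // -(rmorph_nat (real_complex R)) -fmorphV.
by rewrite ltcR.
Qed.

Theorem theorem3p1 (R : realType) (q : nat) (hq : (3 <= q)%N) :
  border_rank (kron (Tcw (Cplx R) q) (Tcw (Cplx R) q)) = ((q + 2) ^ 2)%N.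
Proof.
rewrite /border_rank; case: ex_minnP => r /asboolP lim_r r_min.
apply/eqP; rewrite eqn_leq; apply/andP; split.
  have [t t_neq0 t0] := Cplx_null_seq R.
  exact/r_min/asboolP/(limit_of_rank_le_cw2 q t_neq0 t0).
case: q hq lim_r {r_min} => [|[|[|k]]] // _ /cw2_border_rank_ge.
by apply: leq_trans; rewrite leq_exp2r //; lia.
Qed.
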